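(* Suppose that $S$ is finite or countably infinite. Let $\emptyset\ne C\subseteq S$, let $\alpha:S\to[0,\infty)$, and let $w:S\to(0,\infty)$. For $1\le n\le\infty$, let $P_n=(P_n(x,y):x,y\in S)$ be a transition matrix with a stationary distribution $\pi_n$, and suppose that $P_\infty$ is irreducible. Suppose that for each $x,y\in S$, (i) $P_n(x,y)\to P_\infty(x,y)$ and (ii) $\pi_n(x)\to\pi_\infty(x)$ as $n\to\infty$. If, in addition, $$\sum_{x\in S}\pi_n(x)w(x)\to\sum_{x\in S}\pi_\infty(x)w(x)<\infty$$ as $n\to\infty$, then for every $r:S\to[0,\infty)$ with $r(x)\le w(x)$ for all $x\in S$, and for every $x\in S$, $u_n^*(x)\to u_\infty^*(x)$ as $n\to\infty$, where $$u_n^*(x)=\mathbb{E}_{n,x}\left[\sum_{j=0}^{T}\exp\left(-\sum_{k=0}^{j-1}\alpha(X_k)\right)r(X_j)\right],\qquad T=\inf\{j\ge 0:X_j\in C^c\}.$$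
   Context: The index $n$ ranges over $\{1,2,\dots\}\cup\{\infty\}$. $\mathbb{E}_{n,x}$ is expectation under the law $P_{n,x}$ for which $X=(X_m:m\ge 0)$ is a Markov chain on $S$ with $X_0=x$ and transition matrix $P_n$. A stationary distribution is a probability vector $\pi_n$ with $\sum_{x}\pi_n(x)P_n(x,y)=\pi_n(y)$ for all $y\in S$. $C^c=S\setminus C$ may be empty, in which case $T=\infty$; when $T=\infty$ the sum over $j$ runs over all $j\ge 0$; an empty sum is $0$. The quantities $u_n^*(x)$ take values in $[0,\infty]$, and convergence is in $[0,\infty]$ (so if $u_\infty^*(x)=\infty$ the conclusion is $u_n^*(x)\to\infty$). *)

(* Defs.v *)
From HB Require Import structures.
From mathcomp Require Import all_boot all_order all_algebra.
From mathcomp Require Import all_classical all_reals all_analysis.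

Set Implicit Arguments.
Unset Strict Implicit.
Unset Printing Implicit Defensive.

Import Order.TTheory GRing.Theory Num.Theory.
Import numFieldNormedType.Exports.

Local Open Scope classical_set_scope.
Local Open Scope ring_scope.

(* Sums over the state space are sums of nonnegative terms, taken in [0, +oo]
   with [esum]; the state space is a [countType], i.e. finite or countably
   infinite. *)

Definition transition_matrix (R : realType) (S : countType)
    (p : S -> S -> R) : Prop :=
  (forall x y, 0 <= p x y) /\
  (forall x, esum [set: S] (fun y => (p x y)%:E) = 1%E).

Definition stationary_distribution (R : realType) (S : countType)
    (p : S -> S -> R) (pi : S -> R) : Prop :=
  [/\ forall x, 0 <= pi x,
      esum [set: S] (fun x => (pi x)%:E) = 1%E &
      forall y, esum [set: S] (fun x => (pi x * p x y)%:E) = (pi y)%:E].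

(* m-th power of a nonnegative matrix. *)
Fixpoint matrix_power (R : realType) (S : countType) (p : S -> S -> R)
    (m : nat) (x y : S) : \bar R :=
  if m is m'.+1 then
    esum [set: S] (fun z => ((p x z)%:E * matrix_power p m' z y)%E)
  else (x == y)%:R%:E.

Definition irreducible_matrix (R : realType) (S : countType)
    (p : S -> S -> R) : Prop :=
  forall x y, exists m : nat, (0 < matrix_power p m x y)%E.

(* Pr (A | B); only meaningful when Pr B != 0. *)
Definition cond_prob (d : measure_display) (Omega : measurableType d)
    (R : realType) (Pr : probability Omega R) (A B : set Omega) : R :=
  fine (Pr (A `&` B)) / fine (Pr B).

(* Under the law [Pr], [X] is a Markov chain with X_0 = x (almost surely) and
   transition matrix [p].  The first condition is measurability of each X_m
   for the discrete sigma-algebra on the state space. *)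
Definition markov_chain (d : measure_display) (Omega : measurableType d)
    (R : realType) (S : countType) (Pr : probability Omega R)
    (X : nat -> Omega -> S) (p : S -> S -> R) (x : S) : Prop :=
  [/\ forall (m : nat) (A : set S), measurable (X m @^-1` A),
      Pr [set w | X 0%N w = x] = 1%E &
      forall (m : nat) (s : nat -> S) (y : S),
        let past := [set w | forall i, (i <= m)%N -> X i w = s i] in
        Pr past != 0%E ->
        cond_prob Pr [set w | X m.+1 w = y] past = p (s m) y].

(* T = inf {j >= 0 : X_j \in C^c}, equal to +oo when the set is empty. *)
Definition exit_time (R : realType) (Omega : Type) (S : countType)
    (C : set S) (X : nat -> Omega -> S) (w : Omega) : \bar R :=
  ereal_inf [set (j%:R)%:E | j in [set j : nat | (~` C) (X j w)]].

Definition total_discounted_reward (R : realType) (Omega : Type)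
    (S : countType) (C : set S) (alpha r : S -> R) (X : nat -> Omega -> S)
    (w : Omega) : \bar R :=
  (\sum_(0 <= j <oo | ((j%:R)%:E <= exit_time R C X w)%E)
     (expR (- \sum_(0 <= k < j) alpha (X k w)) * r (X j w))%:E)%E.

(* u^*(x) when [Pr] is the law of the chain started at x.  The library's
   expectation operator is restricted to real-valued random variables, so the
   integral of this [0, +oo]-valued one is written out. *)
Definition ustar (d : measure_display) (Omega : measurableType d)
    (R : realType) (S : countType) (C : set S) (alpha r : S -> R)
    (X : nat -> Omega -> S) (Pr : probability Omega R) : \bar R :=
  (\int[Pr]_w total_discounted_reward C alpha r X w)%E.

(* Main.v *)
Require Import Defs.
From HB Require Import structures.
From mathcomp Require Import all_boot all_order all_algebra.
From mathcomp Require Import all_classical all_reals all_analysis.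
From mathcomp Require Import measurable_realfun lra ring.
Import Order.TTheory GRing.Theory Num.Theory.
Import numFieldNormedType.Exports.
Local Open Scope classical_set_scope.
Local Open Scope ring_scope.

(** With [k = 1_C exp(-alpha)] and [K_n(y,z) = k(y) P_n(y,z)], [u_n^*] is the
    least nonnegative solution [sum_j K_n^j r] of [u = r + K_n u], so Fatou's
    lemma gives [liminf u_n^* >= u_oo^*]. For the upper bound, fix the starting
    state [x] and stop the chain at its first return to [x]. For [P_n] the
    occupation measure of the excursion is at most [pi_n / pi_n(x)], with
    equality for [n = oo] because [P_oo] is irreducible. Hence the expected
    [w]-reward of an excursion is upper semicontinuous; it is the sum of the
    discounted [r]-reward and of a remainder of the same form, and both are
    lower semicontinuous, so both converge. This gives the convergence of the
    discounted reward [h_n] and of the discounted return weight [F_n] of an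
    excursion, where [u_n^*(x) = h_n + F_n u_n^*(x)]. If [F_oo = 1], then
    nothing is discounted, and [u_oo^*(x) = oo] unless [r = 0]. *)

(** * Countable sums *)

Section CountableSums.
Set Implicit Arguments. Unset Strict Implicit.
Context (R : realType).
Local Open Scope ereal_scope.

Lemma esum_ge_term (T : choiceType) (f : T -> \bar R) (i : T) :
  (forall j, 0 <= f j) -> f i <= \esum_(j in [set: T]) f j.
Proof.
move=> f0; rewrite -[leLHS](@esum_set1 R T i f)//.
by rewrite [leLHS]esum_mkcond; apply: le_esum => j _; case: ifP.
Qed.

Lemma esum_eq0P (T : choiceType) (f : T -> \bar R) :
  (forall j, 0 <= f j) -> \esum_(j in [set: T]) f j = 0 -> forall j, f j = 0.
Proof.
move=> f0 f00 j; apply/eqP; rewrite eq_le f0 andbT -f00.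
exact: esum_ge_term.
Qed.

Lemma esum_delta (T : choiceType) (f : T -> \bar R) (i : T) :
  0 <= f i -> (forall j, j != i -> f j = 0) ->
  \esum_(j in [set: T]) f j = f i.
Proof.
move=> f0 fi; rewrite -[RHS](@esum_set1 R T i f)//.
rewrite [RHS]esum_mkcond; apply: eq_esum => j _.
by case: ifPn => //; rewrite in_set1 => /fi.
Qed.

(** Enumerating the type by [pickle_inv] makes the theorems on series available; integers that code
    no element contribute the default 0. *)
Lemma esum_countE (T : countType) (f : T -> \bar R) : (forall j, 0 <= f j) ->
  \esum_(j in [set: T]) f j = \sum_(0 <= n <oo) oapp f 0 (pickle_inv n).
Proof.
move=> f0; have h0 n : 0 <= oapp f 0 (@pickle_inv T n) by case: pickle_inv.
rewrite nneseries_esumT//.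
transitivity (\esum_(n in pickle @` [set: T]) oapp f 0 (@pickle_inv T n)).
  rewrite esum_image; last by move=> a b _ _; exact: (pcan_inj pickleK_inv).
  by apply: eq_esum => j _; rewrite pickleK_inv.
rewrite esum_mkcond; apply: eq_esum => n _.
case: ifPn => //; rewrite notin_setE => hn.
case E : (pickle_inv n) => [a|//]; exfalso; apply: hn.
by exists a => //; have := @pickle_invK T n; rewrite E.
Qed.

Lemma esumZl (T : countType) (c : \bar R) (f : T -> \bar R) :
  0 <= c -> (forall j, 0 <= f j) ->
  \esum_(j in [set: T]) (c * f j) = c * \esum_(j in [set: T]) f j.
Proof.
case: c => [c||//] c0 f0; last first.
  (* For [c = +oo], one positive term makes both sides infinite; otherwise both are 0, since +oo
     times 0 is 0. *)
  have [[i fi]|no] := pselect (exists i, 0 < f i); last first.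
    have f00 i : f i = 0.
      apply/eqP; rewrite eq_le f0 andbT leNgt; apply/negP => fi.
      by apply: no; exists i.
    by rewrite !esum1// ?mule0// => i _; rewrite f00 ?mule0.
  rewrite gt0_mulye; last exact: lt_le_trans fi (esum_ge_term i f0).
  apply/eqP; rewrite -leye_eq.
  apply: (@le_trans _ _ (+oo * f i)); first by rewrite gt0_mulye.
  by apply: (esum_ge_term (f := fun i => +oo * f i)) => j; exact: mule_ge0.
rewrite (esum_countE f0) esum_countE; last by move=> j; exact: mule_ge0.
rewrite -nneseriesZl; last by move=> n _; case: pickle_inv.
by apply: eq_eseriesr => n _; case: pickle_inv => [a|]//=; rewrite mule0.
Qed.

Lemma esum_swap (T U : countType) (f : T -> U -> \bar R) :
  (forall i j, 0 <= f i j) ->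
  \esum_(i in [set: T]) \esum_(j in [set: U]) f i j =
  \esum_(j in [set: U]) \esum_(i in [set: T]) f i j.
Proof.
move=> f0; rewrite !esum_esum//.
rewrite (reindex_esum ([set: T] `*`` (fun=> [set: U])) _
  (fun k : T * U => (k.2, k.1)))//.
by split=> //= [[a b] [c e] _ _ [-> ->]//|[a b] _]; exists (b, a).
Qed.

Lemma esum_nat_recl (f : nat -> \bar R) : (forall j, 0 <= f j) ->
  \esum_(j in [set: nat]) f j = f 0%N + \esum_(j in [set: nat]) f j.+1.
Proof.
move=> f0; rewrite -!nneseries_esumT//.
rewrite nneseries_recl//; congr (_ + _).
rewrite -nneseries_addn//.
by apply: eq_eseriesr => j _; rewrite addn1.
Qed.

Lemma esum_nat_le (f : nat -> \bar R) (l : \bar R) : (forall j, 0 <= f j) ->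
  (forall N, \sum_(0 <= j < N) f j <= l) -> \esum_(j in [set: nat]) f j <= l.
Proof.
move=> f0 fl; rewrite -nneseries_esumT//.
by apply: lime_le; [exact: is_cvg_nneseries|exact: nearW].
Qed.

(** The differences [g i - f i] are nonnegative, and finiteness of the sum of [f] lets one cancel
    it, so they sum to 0. This turns subinvariance into invariance below. *)
Lemma esum_le_eq (T : countType) (f g : T -> \bar R) :
  (forall i, 0 <= f i) -> (forall i, f i <= g i) ->
  \esum_(i in [set: T]) f i < +oo ->
  \esum_(i in [set: T]) g i <= \esum_(i in [set: T]) f i ->
  forall i, f i = g i.
Proof.
move=> f0 fg foo gf.
have ffin i : f i \is a fin_num.
  rewrite ge0_fin_numE//; apply: le_lt_trans foo; exact: esum_ge_term.
have d0 i : 0 <= g i - f i by rewrite sube_ge0//; apply/orP; left.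
have gE : forall i, g i = f i + (g i - f i) by move=> i; rewrite addeC subeK.
have h : \esum_(i in [set: T]) (g i - f i) = 0.
  move: gf; under eq_esum do rewrite gE.
  rewrite esumD// -[leRHS]adde0 leeD2lE ?ge0_fin_numE ?esum_ge0// => le0.
  by apply/eqP; rewrite eq_le le0 esum_ge0.
by move=> i; rewrite [RHS]gE (esum_eq0P d0 h) adde0.
Qed.

End CountableSums.

(** * Potentials of nonnegative matrices *)

Section Potential.
Set Implicit Arguments. Unset Strict Implicit.
Context (R : realType) (S : countType).
Local Open Scope ereal_scope.
Implicit Types (M D : S -> S -> R) (f g v l : S -> \bar R).

Definition mxapp M f (y : S) : \bar R :=
  \esum_(z in [set: S]) ((M y z)%:E * f z).

(** The Neumann series of [M] applied to [f]. With [mxtr M] in place of [M], the same theory covers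
    measures, that is, row vectors. *)
Definition potential M f (y : S) : \bar R :=
  \esum_(j in [set: nat]) iter j (mxapp M) f y.

Definition mxtr M : S -> S -> R := fun y z => M z y.

Definition ge0_mx M := forall y z, (0 <= M y z)%R.
Definition ge0_fun f := forall y, 0 <= f y.

Lemma mxterm_ge0 M f : ge0_mx M -> ge0_fun f ->
  forall y z, 0 <= (M y z)%:E * f z.
Proof. by move=> M0 f0 y z; rewrite mule_ge0// lee_fin. Qed.

Lemma mxapp_ge0 M f : ge0_mx M -> ge0_fun f -> ge0_fun (mxapp M f).
Proof. by move=> M0 f0 y; apply: esum_ge0 => z _; exact: mxterm_ge0. Qed.

Lemma mxapp_ge_term M f y z : ge0_mx M -> ge0_fun f ->
  (M y z)%:E * f z <= mxapp M f y.
Proof.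
move=> M0 f0.
by apply: (esum_ge_term (f := fun z => (M y z)%:E * f z)) => u; exact: mxterm_ge0.
Qed.

Lemma le_mxapp M M' f g : ge0_mx M -> (forall y z, (M y z <= M' y z)%R) ->
  ge0_fun f -> (forall y, f y <= g y) -> forall y, mxapp M f y <= mxapp M' g y.
Proof.
move=> M0 MM f0 fg y; apply: le_esum => z _.
by apply: lee_pmul; rewrite ?lee_fin.
Qed.

Lemma mxappD M f g y : ge0_mx M -> ge0_fun f -> ge0_fun g ->
  mxapp M (fun z => f z + g z) y = mxapp M f y + mxapp M g y.
Proof.
move=> M0 f0 g0; rewrite /mxapp -esumD; try by move=> z _; exact: mxterm_ge0.
by apply: eq_esum => z _; rewrite ge0_muleDr.
Qed.

Lemma mxappDl M D f y : ge0_mx M -> ge0_mx D -> ge0_fun f ->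
  mxapp (fun y z => (M y z + D y z)%R) f y = mxapp M f y + mxapp D f y.
Proof.
move=> M0 D0 f0; rewrite /mxapp -esumD; try by move=> z _; exact: mxterm_ge0.
by apply: eq_esum => z _; rewrite EFinD ge0_muleDl// lee_fin.
Qed.

Lemma mxappZ M (c : \bar R) f y : ge0_mx M -> 0 <= c -> ge0_fun f ->
  mxapp M (fun z => c * f z) y = c * mxapp M f y.
Proof.
move=> M0 c0 f0; rewrite /mxapp -esumZl//; last by move=> z; exact: mxterm_ge0.
by apply: eq_esum => z _; rewrite muleCA.
Qed.

Lemma iter_mxapp_ge0 M f j : ge0_mx M -> ge0_fun f ->
  ge0_fun (iter j (mxapp M) f).
Proof. by move=> M0 f0; elim: j => //= j; exact: mxapp_ge0. Qed.

Lemma potential_ge0 M f : ge0_mx M -> ge0_fun f -> ge0_fun (potential M f).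
Proof. by move=> M0 f0 y; apply: esum_ge0 => j _; exact: iter_mxapp_ge0. Qed.

Lemma potentialE M f y : ge0_mx M -> ge0_fun f ->
  potential M f y = f y + mxapp M (potential M f) y.
Proof.
move=> M0 f0; rewrite {1}/potential esum_nat_recl; last first.
  by move=> j; exact: iter_mxapp_ge0.
congr (_ + _) => /=; rewrite [LHS]esum_swap; last first.
  by move=> j z; apply: mxterm_ge0 => //; exact: iter_mxapp_ge0.
by apply: eq_esum => z _; rewrite esumZl// ?lee_fin// => j; exact: iter_mxapp_ge0.
Qed.

Lemma partial_potentialS M f N y : ge0_mx M -> ge0_fun f ->
  \sum_(0 <= j < N.+1) iter j (mxapp M) f y =
  f y + mxapp M (fun z => \sum_(0 <= j < N) iter j (mxapp M) f z) y.
Proof.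
move=> M0 f0; have i0 := iter_mxapp_ge0 _ M0 f0.
rewrite big_nat_recl//; congr (_ + _) => /=; rewrite -esum_sum; last first.
  by move=> z j _ _; exact: mxterm_ge0.
by apply: eq_esum => z _; rewrite ge0_sume_distrr// => j _; exact: i0.
Qed.

(** By induction every partial sum of the series stays below the supersolution [v]. Most upper
    bounds on potentials below come from this minimality. *)
Lemma potential_min M f v : ge0_mx M -> ge0_fun f -> ge0_fun v ->
  (forall y, f y + mxapp M v y <= v y) -> forall y, potential M f y <= v y.
Proof.
move=> M0 f0 v0 sup y; have i0 := iter_mxapp_ge0 _ M0 f0.
apply: esum_nat_le => [j|N]; first exact: i0.
elim: N y => [|N IH] y; first by rewrite big_geq.
rewrite partial_potentialS//; apply: le_trans (sup y); apply: leeD2l.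
by apply: le_mxapp => // z; apply: sume_ge0 => j _; exact: i0.
Qed.

Lemma le_potential M M' f g : ge0_mx M -> (forall y z, (M y z <= M' y z)%R) ->
  ge0_fun f -> (forall y, f y <= g y) ->
  forall y, potential M f y <= potential M' g y.
Proof.
move=> M0 MM f0 fg.
have M'0 : ge0_mx M' by move=> y z; exact: le_trans (MM y z).
have g0 : ge0_fun g by move=> y; exact: le_trans (fg y).
apply: potential_min => //; first exact: potential_ge0.
move=> y; rewrite [leRHS]potentialE//; apply: leeD => //.
by apply: le_mxapp => //; exact: potential_ge0.
Qed.

Lemma iter_mxappD M f g j : ge0_mx M -> ge0_fun f -> ge0_fun g -> forall y,
  iter j (mxapp M) (fun z => f z + g z) y =
  iter j (mxapp M) f y + iter j (mxapp M) g y.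
Proof.
move=> M0 f0 g0; elim: j => //= j IH y.
rewrite -mxappD//; try exact: iter_mxapp_ge0.
by congr (mxapp M _ y); exact/funext.
Qed.

Lemma potentialD M f g y : ge0_mx M -> ge0_fun f -> ge0_fun g ->
  potential M (fun z => f z + g z) y = potential M f y + potential M g y.
Proof.
move=> M0 f0 g0; rewrite /potential -esumD; try by move=> j _; exact: iter_mxapp_ge0.
by apply: eq_esum => j _; exact: iter_mxappD.
Qed.

Lemma potentialZ M (c : \bar R) f y : ge0_mx M -> 0 <= c -> ge0_fun f ->
  potential M (fun z => c * f z) y = c * potential M f y.
Proof.
move=> M0 c0 f0; rewrite /potential -esumZl//; last first.
  by move=> j; exact: iter_mxapp_ge0.
apply: eq_esum => j _; elim: j y => //= j IH y.
rewrite -mxappZ//; last exact: iter_mxapp_ge0.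
by congr (mxapp M _ y); exact/funext.
Qed.

Lemma mxapp_duality M l f : ge0_mx M -> ge0_fun l -> ge0_fun f ->
  \esum_(y in [set: S]) (l y * mxapp M f y) =
  \esum_(z in [set: S]) (mxapp (mxtr M) l z * f z).
Proof.
move=> M0 l0 f0.
transitivity (\esum_(y in [set: S]) \esum_(z in [set: S])
    (l y * ((M y z)%:E * f z))).
  by apply: eq_esum => y _; rewrite esumZl// => z; exact: mxterm_ge0.
rewrite esum_swap; last by move=> y z; rewrite mule_ge0// mxterm_ge0.
apply: eq_esum => z _; rewrite muleC -esumZl//; last first.
  by move=> y; apply: mule_ge0; rewrite ?lee_fin//; exact: M0.
by apply: eq_esum => y _; rewrite [LHS]muleCA [RHS]muleC -muleA.
Qed.

(** By Tonelli, the factors [M] of the j-th term are moved one at a time from the function [f] to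
    the measure [l]. *)
Lemma potential_duality M l f : ge0_mx M -> ge0_fun l -> ge0_fun f ->
  \esum_(y in [set: S]) (l y * potential M f y) =
  \esum_(z in [set: S]) (potential (mxtr M) l z * f z).
Proof.
move=> M0 l0 f0; have M0' : ge0_mx (mxtr M) by move=> y z; exact: M0.
transitivity (\esum_(y in [set: S]) \esum_(j in [set: nat])
    (l y * iter j (mxapp M) f y)).
  by apply: eq_esum => y _; rewrite esumZl// => j; exact: iter_mxapp_ge0.
rewrite esum_swap; last by move=> y j; rewrite mule_ge0//; exact: iter_mxapp_ge0.
transitivity (\esum_(j in [set: nat]) \esum_(z in [set: S])
    (iter j (mxapp (mxtr M)) l z * f z)).
  apply: eq_esum => j _; elim: j l l0 => [|j IH] l l0 //.
  rewrite iterS mxapp_duality//; last exact: iter_mxapp_ge0.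
  rewrite IH; last exact: mxapp_ge0.
  by apply: eq_esum => z _; rewrite iterSr.
rewrite esum_swap; last by move=> j z; rewrite mule_ge0//; exact: iter_mxapp_ge0.
apply: eq_esum => z _; rewrite muleC -esumZl//; last first.
  by move=> j; exact: iter_mxapp_ge0.
by apply: eq_esum => j _; rewrite muleC.
Qed.

(** The resolvent identity. Values may be infinite, so instead of subtracting one proves two
    inequalities, each by minimality of a potential. *)
Lemma potential_resolvent M D f y : ge0_mx M -> ge0_mx D -> ge0_fun f ->
  let a := potential (fun y z => (M y z + D y z)%R) f in
  potential M (fun z => f z + mxapp D a z) y = a y.
Proof.
move=> M0 D0 f0 a; have N0 : ge0_mx (fun y z => (M y z + D y z)%R).
  by move=> u z; exact: addr_ge0 (M0 u z) (D0 u z).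
have a0 : ge0_fun a by exact: potential_ge0.
have Da0 : ge0_fun (mxapp D a) by exact: mxapp_ge0.
have g0 : ge0_fun (fun z => f z + mxapp D a z) by move=> z; rewrite adde_ge0.
have aE u : a u = f u + mxapp D a u + mxapp M a u.
  rewrite {1}/a potentialE// -/a mxappDl// -addeA; congr (_ + _).
  exact: addeC.
have le1 : forall u, potential M (fun z => f z + mxapp D a z) u <= a u.
  by apply: potential_min => // u; rewrite -aE.
set v := potential M _ in le1 *; have v0 : ge0_fun v by exact: potential_ge0.
have vE u : v u = f u + mxapp D a u + mxapp M v u by exact: potentialE.
apply/eqP; rewrite eq_le le1/= {1}/a.
(* [v] is a supersolution for M + D: v = f + D a + M v >= f + D v + M v, because v <= a. *)
move: v v0 vE le1 => v v0 vE le1; apply: potential_min => // u.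
rewrite mxappDl// [leRHS]vE [leRHS]addeAC addeA.
by apply: leeD2l; exact: le_mxapp.
Qed.

End Potential.

(** * Semicontinuity *)

Section SemicontinuousLimits.
Set Implicit Arguments. Unset Strict Implicit.
Context (R : realType).
Local Open Scope ereal_scope.
Implicit Types (u v : nat -> \bar R) (A B : \bar R).

(** These say liminf u >= A and limsup u <= A through real thresholds; for [A = +oo] the first is
    divergence to +oo and the second is vacuous. *)
Definition lsc_lim u A := forall t : R, t%:E < A -> \forall n \near \oo, t%:E < u n.
Definition usc_lim u A := forall t : R, A < t%:E -> \forall n \near \oo, u n < t%:E.

Lemma cvg_lsc_lim u A : u n @[n --> \oo] --> A -> lsc_lim u A.
Proof.
move=> uA t tA; apply: (uA [set y | t%:E < y]); apply: open_nbhs_nbhs.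
by split => //; exact: open_ereal_gt_ereal.
Qed.

Lemma cvg_usc_lim u A : u n @[n --> \oo] --> A -> usc_lim u A.
Proof.
move=> uA t tA; apply: (uA [set y | y < t%:E]); apply: open_nbhs_nbhs.
by split => //; exact: open_ereal_lt_ereal.
Qed.

Lemma lsc_usc_cvg u A : 0 <= A -> lsc_lim u A -> usc_lim u A ->
  u n @[n --> \oo] --> A.
Proof.
case: A => [a _ lu uu|_ lu _|//]; last by apply/cvgeyPgt => t; exact/lu/ltry.
move=> U /=; rewrite /nbhs/= => -[e/= e0 eU].
have h1 : \forall n \near \oo, (a - e)%:E < u n.
  by apply: lu; rewrite lte_fin ltrBlDr ltrDl.
have h2 : \forall n \near \oo, u n < (a + e)%:E.
  by apply: uu; rewrite lte_fin ltrDl.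
near=> n.
have : (a - e)%:E < u n by near: n.
have : u n < (a + e)%:E by near: n.
case E : (u n) => [x||//]; rewrite ?lte_fin//= => h3 h4.
by rewrite E; apply: eU => /=; rewrite ltr_distlC; apply/andP; split.
Unshelve. all: by end_near. Qed.

Lemma cst_lsc_lim A : lsc_lim (fun=> A) A.
Proof. by move=> t tA; exact: nearW. Qed.

Lemma lsc_limD u v A B : 0 <= A -> 0 <= B ->
  lsc_lim u A -> lsc_lim v B -> lsc_lim (fun n => u n + v n) (A + B).
Proof.
move=> A0 B0 uA vB t tAB.
suff [s [r [sA rB tE]]] : exists s r : R, [/\ s%:E < A, r%:E < B & t = (s + r)%R].
  have h1 := uA _ sA; have h2 := vB _ rB.
  by near=> n; rewrite tE EFinD lteD//; near: n.
case: A A0 tAB uA => [a||//] A0 tAB uA; last first.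
  (* A negative threshold lies below [B >= 0], and the infinite [A] exceeds any real number. *)
  exists (t + 1)%R, (- 1)%R; rewrite ltry addrK; split => //.
  by apply: lt_le_trans B0; rewrite lte_fin ltrN10.
case: B B0 tAB vB => [b||//] B0 tAB vB; last first.
  exists (- 1)%R, (t + 1)%R; rewrite ltry addrC addrK; split => //.
  by apply: lt_le_trans A0; rewrite lte_fin ltrN10.
move: tAB; rewrite -EFinD lte_fin => tAB.
exists (a - (a + b - t) / 2)%R, (b - (a + b - t) / 2)%R.
by rewrite !lte_fin; split; lra.
Unshelve. all: by end_near. Qed.

Lemma lsc_limM (a : nat -> R) (a' : R) v B :
  (forall n, (0 <= a n)%R) -> (0 <= a')%R -> (forall n, 0 <= v n) -> 0 <= B ->
  a n @[n --> \oo] --> a' -> lsc_lim v B ->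
  lsc_lim (fun n => (a n)%:E * v n) (a'%:E * B).
Proof.
move=> a0 a'0 v0 B0 aa vB t tAB.
have av0 n : 0 <= (a n)%:E * v n by rewrite mule_ge0// lee_fin.
(* For [t < 0] nonnegativity suffices; for [t >= 0] both factors of the limit are positive, which
   excludes the products of 0 and +oo. *)
have [t0|t0] := ltP t 0%R.
  by apply: nearW => n; apply: lt_le_trans (av0 n); rewrite lte_fin.
have ap : (0 < a')%R.
  rewrite lt_neqAle a'0 andbT; apply/negP => /eqP E.
  by move: tAB; rewrite -E mul0e lte_fin ltNge t0.
have Bp : 0 < B.
  rewrite lt_neqAle B0 andbT; apply/negP => /eqP E.
  by move: tAB; rewrite -E mule0 lte_fin ltNge t0.
suff [s [r [sA rB s0 r0 tE]]] : exists s r : R,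
    [/\ (s < a')%R, r%:E < B, (0 < s)%R, (0 < r)%R & (t <= s * r)%R].
  have h1 : \forall n \near \oo, (s < a n)%R by exact: cvgr_gt aa _ sA.
  have h2 := vB _ rB.
  near=> n; apply: (@le_lt_trans _ _ (s * r)%:E); first by rewrite lee_fin.
  rewrite EFinM; apply: lte_pmul; rewrite ?lee_fin ?(ltW s0) ?(ltW r0)// ?lte_fin;
    by near: n.
case: B B0 tAB vB Bp => [b||//] B0 tAB vB Bp; last first.
  exists (a' / 2)%R, ((t + 1) / (a' / 2))%R; rewrite ltry.
  have h : (0 < a' / 2)%R by rewrite divr_gt0.
  split => //; first by lra.
    by rewrite divr_gt0//; lra.
  by rewrite mulrC divfK ?gt_eqF//; lra.
move: Bp tAB; rewrite -EFinM !lte_fin => Bp tAB.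
(* Both limits are shrunk by the same factor [q], the mean of 1 and [tau], so that q^2 >= tau. *)
pose tau := (t / (a' * b))%R; pose q := ((1 + tau) / 2)%R.
have ab0 : (0 < a' * b)%R by rewrite mulr_gt0.
have tau0 : (0 <= tau)%R by rewrite divr_ge0// ltW.
have tau1 : (tau < 1)%R by rewrite ltr_pdivrMr// mul1r.
have tE : t = (tau * (a' * b))%R by rewrite divfK// gt_eqF.
have q1 : (q < 1)%R by rewrite /q; lra.
have q0 : (0 < q)%R by rewrite /q; lra.
exists (q * a')%R, (q * b)%R; split; try exact: mulr_gt0.
- by rewrite gtr_pMl.
- by rewrite lte_fin gtr_pMl.
- rewrite tE [leRHS]mulrACA ler_pM2r// /q; clearbody tau.
  have -> : ((1 + tau) / 2 * ((1 + tau) / 2) = tau + ((1 - tau) / 2) ^+ 2)%R by field.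
  by rewrite lerDl sqr_ge0.
Unshelve. all: by end_near. Qed.

(* Fatou's lemma for countable sums. *)
Lemma lsc_lim_esum (T : choiceType) (f : nat -> T -> \bar R) (g : T -> \bar R) :
  (forall n i, 0 <= f n i) -> (forall i, 0 <= g i) ->
  (forall i, lsc_lim (f ^~ i) (g i)) ->
  lsc_lim (fun n => \esum_(i in [set: T]) f n i) (\esum_(i in [set: T]) g i).
Proof.
(* A threshold below the sum is already below a finite partial sum, to which [lsc_limD] applies term
   by term. *)
move=> f0 g0 fg t /ereal_sup_gt[_ [X [finX XT] <-]].
rewrite fsbig_finite//= => tX.
set r := finmap.enum_fset _ in tX *.
have : lsc_lim (fun n => \sum_(i <- r) f n i) (\sum_(i <- r) g i).
  elim: {tX}r => [|i s IH].
    by under eq_fun do rewrite big_nil; rewrite big_nil; exact: cst_lsc_lim.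
  under eq_fun do rewrite big_cons; rewrite big_cons.
  by apply: lsc_limD => //; exact: sume_ge0.
move=> /(_ _ tX); apply: filterS => n h; apply: (lt_le_trans h).
by apply: esum_ge; exists X => //; rewrite fsbig_finite.
Qed.

(** Since v <= u - z, limsup v <= limsup u - liminf z <= A - Z <= B; finiteness of [A] gives the
    subtraction a meaning. *)
Lemma usc_lim_cancel u v z A B Z : 0 <= A -> A < +oo -> 0 <= Z ->
  (forall n, v n + z n <= u n) -> A <= B + Z ->
  usc_lim u A -> lsc_lim z Z -> usc_lim v B.
Proof.
move=> A0 Aoo Z0 vzu ABZ uA zZ t Bt.
(* With [M] between A and t + Z, the bounds v >= t and z > M - t would force u >= M. *)
suff [M [AM MZ]] : exists M : R, A < M%:E /\ (M - t)%:E < Z.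
  have h1 := uA _ AM; have h2 := zZ _ MZ.
  near=> n; rewrite ltNge; apply/negP => tv.
  have : u n < M%:E by near: n.
  rewrite ltNge => /negP; apply; apply: le_trans (vzu n).
  rewrite -[M in M%:E](subrKC t) EFinD; apply: leeD => //; apply: ltW.
  by near: n.
case: A A0 Aoo ABZ uA => [a||//] A0 Aoo ABZ uA //.
case: Z Z0 ABZ zZ => [c||//] Z0 ABZ zZ; last first.
  by exists (a + 1)%R; rewrite ltry lte_fin ltrDl.
have : a%:E < (t + c)%:E by apply: (le_lt_trans ABZ); rewrite EFinD lteD2rE.
rewrite lte_fin => atc; exists ((a + (t + c)) / 2)%R; rewrite !lte_fin.
by split; lra.
Unshelve. all: by end_near. Qed.

End SemicontinuousLimits.

(** * Semicontinuity of potentials *)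

Section SemicontinuousPotential.
Set Implicit Arguments. Unset Strict Implicit.
Context (R : realType) (S : countType).
Local Open Scope ereal_scope.

Lemma lsc_lim_mxapp (M : nat -> S -> S -> R) (M' : S -> S -> R)
    (f : nat -> S -> \bar R) (f' : S -> \bar R) :
  (forall n, ge0_mx (M n)) -> ge0_mx M' ->
  (forall y z, M n y z @[n --> \oo] --> M' y z) ->
  (forall n, ge0_fun (f n)) -> ge0_fun f' ->
  (forall y, lsc_lim (f ^~ y) (f' y)) ->
  forall y, lsc_lim (fun n => mxapp (M n) (f n) y) (mxapp M' f' y).
Proof.
move=> M0 M'0 MM f0 f'0 ff y.
apply: (lsc_lim_esum (f := fun n z => (M n y z)%:E * f n z)).
- by move=> n z; exact: mxterm_ge0.
- by move=> z; exact: mxterm_ge0.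
- by move=> z; apply: lsc_limM => // n; [exact: M0|exact: f0].
Qed.

Lemma lsc_lim_potential (M : nat -> S -> S -> R) (M' : S -> S -> R)
    (f : nat -> S -> \bar R) (f' : S -> \bar R) :
  (forall n, ge0_mx (M n)) -> ge0_mx M' ->
  (forall y z, M n y z @[n --> \oo] --> M' y z) ->
  (forall n, ge0_fun (f n)) -> ge0_fun f' ->
  (forall y, lsc_lim (f ^~ y) (f' y)) ->
  forall y, lsc_lim (fun n => potential (M n) (f n) y) (potential M' f' y).
Proof.
move=> M0 M'0 MM f0 f'0 ff y.
apply: (lsc_lim_esum (f := fun n j => iter j (mxapp (M n)) (f n) y)).
- by move=> n j; exact: iter_mxapp_ge0.
- by move=> j; exact: iter_mxapp_ge0.
- move=> j; elim: j y => [|j IH] y /=; first exact: ff.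
  apply: (lsc_lim_mxapp (f := fun n => iter j (mxapp (M n)) (f n))) => //.
  + by move=> n; exact: iter_mxapp_ge0.
  + exact: iter_mxapp_ge0.
Qed.

End SemicontinuousPotential.

(** * Excursions from a state *)

Section Taboo.
Set Implicit Arguments. Unset Strict Implicit.
Context (R : realType) (S : countType).
Local Open Scope ereal_scope.
Implicit Types (M : S -> S -> R) (f : S -> \bar R) (x y z : S).

(** Only entries into [x] are deleted, so a path may start at [x] but not return to it. *)
Definition taboo x M : S -> S -> R := fun y z => if z == x then 0%R else M y z.

Definition delta x : S -> \bar R := fun y => (y == x)%:R%:E.

(* Expected number of visits before the first return to [x], for the chain
   started at [x]. *)
Definition occupation x M : S -> \bar R := potential (mxtr (taboo x M)) (delta x).

Lemma taboo_ge0 x M : ge0_mx M -> ge0_mx (taboo x M).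
Proof. by move=> M0 y z; rewrite /taboo; case: ifP. Qed.

Lemma mxtr_ge0 M : ge0_mx M -> ge0_mx (mxtr M).
Proof. by move=> M0 y z; exact: M0. Qed.

Lemma delta_ge0 x : ge0_fun (delta x).
Proof. by move=> y; rewrite lee_fin. Qed.

Lemma occupation_ge0 x M : ge0_mx M -> ge0_fun (occupation x M).
Proof.
move=> M0; apply: potential_ge0; last exact: delta_ge0.
exact/mxtr_ge0/taboo_ge0.
Qed.

Lemma mxapp_taboo x M f y : ge0_mx M -> ge0_fun f ->
  mxapp M f y = (M y x)%:E * f x + mxapp (taboo x M) f y.
Proof.
move=> M0 f0.
have -> : (M y x)%:E * f x =
    \esum_(z in [set: S]) (if z == x then (M y z)%:E * f z else 0).
  rewrite (esum_delta (i := x)) ?eqxx ?mxterm_ge0// => z /negbTE -> //.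
rewrite -esumD.
- apply: eq_esum => z _; rewrite /taboo; case: ifP => _; last by rewrite add0e.
  by rewrite mul0e adde0.
- by move=> z _; case: ifP => // _; exact: mxterm_ge0.
- by move=> z _; apply: mxterm_ge0 => //; exact: taboo_ge0.
Qed.

Lemma mxapp_mxtr_taboo x M f y :
  mxapp (mxtr (taboo x M)) f y = if y == x then 0 else mxapp (mxtr M) f y.
Proof.
rewrite /mxapp /mxtr /taboo; case: ifP => // _.
by rewrite esum1// => z _; rewrite mul0e.
Qed.

Lemma occupationE x M y : ge0_mx M ->
  occupation x M y = if y == x then 1 else mxapp (mxtr M) (occupation x M) y.
Proof.
move=> M0; rewrite {1}/occupation potentialE; first last.
- exact: delta_ge0.
- exact/mxtr_ge0/taboo_ge0.
rewrite mxapp_mxtr_taboo /delta; case: eqP => _; first by rewrite adde0.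
by rewrite add0e.
Qed.

Lemma potential_taboo x M f : ge0_mx M -> ge0_fun f ->
  potential (taboo x M) f x = \esum_(y in [set: S]) (occupation x M y * f y).
Proof.
move=> M0 f0; rewrite -potential_duality//; last 2 first.
- exact: taboo_ge0.
- exact: delta_ge0.
rewrite (esum_delta (i := x)) /delta ?eqxx ?mul1e//.
  by apply: potential_ge0 => //; exact: taboo_ge0.
by move=> z /negbTE ->; rewrite mul0e.
Qed.

Lemma esum_mxapp_mxtr M f : ge0_mx M -> ge0_fun f ->
  \esum_(z in [set: S]) mxapp (mxtr M) f z =
  \esum_(y in [set: S]) (f y * mxapp M (fun=> 1) y).
Proof.
move=> M0 f0; rewrite mxapp_duality//.
by apply: eq_esum => z _; rewrite mule1.
Qed.

(** * Occupation measures and stationary distributions *)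

Section Stationary.
Context (p : S -> S -> R) (pi : S -> R).
Context (hp : transition_matrix p) (hpi : stationary_distribution p pi).

Let p0 : ge0_mx p. Proof. by case: hp. Qed.
Let pi0 y : 0 <= (pi y)%:E. Proof. by case: hpi => h _ _; rewrite lee_fin. Qed.

Lemma mxapp_transition y : mxapp p (fun=> 1) y = 1.
Proof.
by case: hp => _ h; rewrite -[RHS](h y); apply: eq_esum => z _; rewrite mule1.
Qed.

Lemma mxapp_stationary y : mxapp (mxtr p) (EFin \o pi) y = (pi y)%:E.
Proof.
case: hpi => _ _ /(_ y) <-; apply: eq_esum => z _.
by rewrite EFinM muleC.
Qed.

(** By stationarity [pi] is a supersolution of the equation whose least solution is the left side:
    it solves it off [x], and at [x] both source and solution equal [pi x]. *)
Lemma occupation_le_stationary x y :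
  (pi x)%:E * occupation x p y <= (pi y)%:E.
Proof.
have t0 : ge0_mx (mxtr (taboo x p)) by exact/mxtr_ge0/taboo_ge0.
rewrite -potentialZ//; last exact: delta_ge0.
apply: (potential_min (v := EFin \o pi)) => // [u|u].
  by rewrite mule_ge0// delta_ge0.
rewrite mxapp_mxtr_taboo mxapp_stationary /delta.
by case: eqP => [->|_]; rewrite ?mule1 ?mule0 ?adde0 ?add0e.
Qed.

Lemma potential_taboo_le_stationary x f : ge0_fun f ->
  (pi x)%:E * potential (taboo x p) f x <=
  \esum_(y in [set: S]) ((pi y)%:E * f y).
Proof.
move=> f0; rewrite potential_taboo// -esumZl//; last first.
  by move=> y; rewrite mule_ge0// occupation_ge0.
apply: le_esum => y _; rewrite muleA; apply: lee_wpmul2r => //.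
exact: occupation_le_stationary.
Qed.

Context (hirr : irreducible_matrix p).

(** Positivity spreads along a path of positive weight, since m(z) >= p(x,z) m(x); the induction is
    on the length of the path, for all starting states. *)
Lemma excessive_gt0 (m : S -> \bar R) : ge0_fun m ->
  (forall y, mxapp (mxtr p) m y <= m y) ->
  forall x, 0 < m x -> forall y, 0 < m y.
Proof.
move=> m0 mle x mx y; have [k] := hirr x y.
elim: k x mx => [|k IH] x mx /=.
  by case: eqP => [<-//|_]; rewrite ltxx.
move=> pk.
have pw0 j : forall u v, 0 <= matrix_power p j u v.
  elim: j => [|j IHj] u v /=; first by rewrite lee_fin.
  by apply: esum_ge0 => z _; rewrite mule_ge0// lee_fin p0.
have [z /andP[pz kz]] : exists z, (0 < p x z)%R && (0 < matrix_power p k z y).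
  apply: contrapT => no; move: pk; rewrite esum1 ?ltxx// => z _.
  have [pz|pz] := ltP 0%R (p x z); last first.
    by have -> : p x z = 0%R; [apply/eqP; rewrite eq_le pz p0|rewrite mul0e].
  have [kz|kz] := ltP 0 (matrix_power p k z y).
    by exfalso; apply: no; exists z; rewrite pz.
  by have -> : matrix_power p k z y = 0; [apply/eqP; rewrite eq_le kz pw0|rewrite mule0].
apply: (IH z) => //; apply: lt_le_trans (mle z).
apply: lt_le_trans (mxapp_ge_term z x (mxtr_ge0 p0) m0).
by rewrite mule_gt0// lte_fin.
Qed.

Lemma stationary_gt0 x : (0 < pi x)%R.
Proof.
rewrite -lte_fin; have [y piy] : exists y, 0 < (pi y)%:E.
  apply: contrapT => no; case: hpi => _ h _; move: h; rewrite esum1.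
    by move=> /eqP; rewrite eqe eq_sym oner_eq0.
  move=> y _; apply/eqP; rewrite eq_le pi0 andbT leNgt; apply/negP => h.
  by apply: no; exists y.
apply: (excessive_gt0 (m := EFin \o pi)) piy x => // y'.
by rewrite mxapp_stationary.
Qed.

(** The defect [mu] of the inequality above is nonnegative, of finite mass, zero at [x] and
    satisfies mu <= mu p. Rows of [p] sum to 1, so mu = mu p, and irreducibility would carry any
    positive value of [mu] to [x]. *)
Lemma occupation_stationary x y :
  (pi x)%:E * occupation x p y = (pi y)%:E.
Proof.
pose mu y := (pi y)%:E - (pi x)%:E * occupation x p y.
have o0 : ge0_fun (occupation x p) by exact: occupation_ge0.
have mu0 : ge0_fun mu by move=> u; rewrite /mu sube_ge0 ?occupation_le_stationary// orbT.
have q0 : ge0_mx (mxtr p) by exact: mxtr_ge0.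
have xo0 : ge0_fun (fun u => (pi x)%:E * occupation x p u) by move=> u; rewrite mule_ge0.
have xof u : (pi x)%:E * occupation x p u \is a fin_num.
  by rewrite ge0_fin_numE//; apply: le_lt_trans (ltry (pi u)); exact: occupation_le_stationary.
have piE u : (pi u)%:E = mu u + (pi x)%:E * occupation x p u by rewrite subeK.
have mux : mu x = 0.
  by rewrite /mu occupationE// eqxx mule1 subee.
have PmuE u : u != x -> mxapp (mxtr p) mu u = mu u.
  move=> ux; have := mxapp_stationary u.
  have -> : EFin \o pi = fun u => mu u + (pi x)%:E * occupation x p u.
    by apply/funext => v /=; rewrite -piE.
  rewrite mxappD// mxappZ// [RHS]piE.
  have -> : mxapp (mxtr p) (occupation x p) u = occupation x p u.
    by rewrite [RHS]occupationE// (negbTE ux).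
  move=> h; have := congr1 (fun t => t - (pi x)%:E * occupation x p u) h.
  by rewrite !addeK.
have mule : forall u, mu u <= mxapp (mxtr p) mu u.
  move=> u; have [->|ux] := eqVneq u x; last by rewrite PmuE.
  by rewrite mux; exact: mxapp_ge0.
have summu : \esum_(u in [set: S]) mu u < +oo.
  apply: (@le_lt_trans _ _ (\esum_(u in [set: S]) (pi u)%:E)).
    by apply: le_esum => u _; rewrite /mu leeBlDr// leeDl.
  by case: hpi => _ -> _; rewrite ltry.
(* Applying [p] preserves total mass, so the termwise inequality is an equality. *)
have inv : forall u, mu u = mxapp (mxtr p) mu u.
  apply: esum_le_eq => //.
  rewrite esum_mxapp_mxtr//.
  by apply: le_esum => u _; rewrite mxapp_transition mule1.
suff muy0 : mu y = 0 by rewrite [RHS]piE muy0 add0e.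
apply/eqP; rewrite eq_le mu0 andbT leNgt; apply/negP => muy.
have : 0 < mu x by apply: (@excessive_gt0 mu mu0 _ y muy x) => u; rewrite -inv.
by rewrite mux ltxx.
Qed.

Lemma potential_taboo_stationary x f : ge0_fun f ->
  (pi x)%:E * potential (taboo x p) f x =
  \esum_(y in [set: S]) ((pi y)%:E * f y).
Proof.
move=> f0; rewrite potential_taboo// -esumZl//; last first.
  by move=> y; rewrite mule_ge0// occupation_ge0.
by apply: eq_esum => y _; rewrite muleA occupation_stationary.
Qed.

End Stationary.
End Taboo.

(** * Discounted kernels *)

Section DiscountedKernel.
Set Implicit Arguments. Unset Strict Implicit.
Context (R : realType) (S : countType).
Local Open Scope ereal_scope.
Implicit Types (p : S -> S -> R) (pi w r : S -> R) (x y z : S).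

Definition scalemx (k : S -> R) p : S -> S -> R := fun y z => (k y * p y z)%R.

Definition discount (k : S -> R) := forall y, (0 <= k y <= 1)%R.

Lemma EFin_ge0_fun w : (forall y, (0 <= w y)%R) -> ge0_fun (EFin \o w).
Proof. by move=> w0 y; rewrite lee_fin. Qed.

Lemma scalemx_ge0 k p : (forall y, (0 <= k y)%R) -> ge0_mx p -> ge0_mx (scalemx k p).
Proof. by move=> k0 p0 y z; rewrite mulr_ge0// p0. Qed.

Lemma discount_ge0 k : discount k -> forall y, (0 <= k y)%R.
Proof. by move=> k01 y; have /andP[] := k01 y. Qed.

Lemma discount_le1 k : discount k -> forall y, (k y <= 1)%R.
Proof. by move=> k01 y; have /andP[] := k01 y. Qed.

Lemma scalemx_le k p y z : discount k -> ge0_mx p -> (scalemx k p y z <= p y z)%R.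
Proof. by move=> k01 p0; rewrite ler_piMl ?discount_le1 ?p0. Qed.

Lemma mxapp_scalemx1 k p y : (forall y, (0 <= k y)%R) -> transition_matrix p ->
  mxapp (scalemx k p) (fun=> 1) y = (k y)%:E.
Proof.
move=> k0 hp; transitivity ((k y)%:E * mxapp p (fun=> 1) y); last first.
  by rewrite mxapp_transition// mule1.
rewrite /mxapp -esumZl.
- by apply: eq_esum => z _; rewrite EFinM muleA.
- by rewrite lee_fin.
- by move=> z; rewrite mule1 lee_fin; case: hp => + _; apply.
Qed.

Lemma transition_le1 p y z : transition_matrix p -> (p y z <= 1)%R.
Proof.
move=> hp; rewrite -lee_fin -(mxapp_transition hp y) -[leLHS]mule1.
by apply: (mxapp_ge_term (f := fun=> 1)) => //; case: hp.
Qed.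

(** The resolvent identity for p = k p + (1 - k) p off [x]. The second term is the remainder: the
    part [w - th] of the reward and what is still to be earned after discounting removes mass. *)
Lemma potential_taboo_split k p x w (th : S -> R) :
  discount k -> ge0_mx p -> (forall y, (0 <= th y <= w y)%R) ->
  let a := potential (taboo x p) (EFin \o w) in
  a x = potential (taboo x (scalemx k p)) (EFin \o th) x +
        potential (taboo x (scalemx k p))
          (fun y => (w y - th y)%:E +
                    mxapp (taboo x (scalemx (fun z => 1 - k z)%R p)) a y) x.
Proof.
move=> k01 p0 thw a.
have k0 := discount_ge0 k01.
have k'0 y : (0 <= 1 - k y)%R by rewrite subr_ge0 discount_le1.
have w0 : forall y, (0 <= w y)%R by move=> y; have /andP[/le_trans + ?] := thw y; exact.
have K0 := taboo_ge0 x (scalemx_ge0 k0 p0).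
have D0 := taboo_ge0 x (scalemx_ge0 k'0 p0).
have a0 : ge0_fun a by apply: potential_ge0; [exact: taboo_ge0|exact: EFin_ge0_fun].
rewrite -potentialD//; first last.
- move=> y; rewrite adde_ge0 ?lee_fin ?subr_ge0//; last exact: mxapp_ge0.
  by have /andP[] := thw y.
- by move=> y; rewrite lee_fin; have /andP[] := thw y.
have := potential_resolvent x K0 D0 (EFin_ge0_fun w0).
have -> : (fun y z => taboo x (scalemx k p) y z +
    taboo x (scalemx (fun z => 1 - k z)%R p) y z)%R = taboo x p.
  apply/funext => y; apply/funext => z; rewrite /taboo /scalemx.
  by case: ifP => _; [rewrite addr0|rewrite -mulrDl subrKC mul1r].
rewrite -/a => <-; congr potential; apply/funext => y /=.
by rewrite addeA -EFinD subrKC.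
Qed.

(** Isolating the entries into [x] shows that u = [potential M r] solves the excursion equation with
    source r + M(.,x) u(x), whose least solution at [x] is the left side. *)
Lemma potential_ge_return M (r : S -> \bar R) x : ge0_mx M -> ge0_fun r ->
  potential (taboo x M) r x +
  potential (taboo x M) (fun y => (M y x)%:E) x * potential M r x <=
  potential M r x.
Proof.
move=> M0 r0; have K0 := taboo_ge0 x M0.
have u0 := potential_ge0 M0 r0.
have Mx0 : ge0_fun (fun y => (M y x)%:E) by move=> y; rewrite lee_fin M0.
rewrite muleC -potentialZ// -potentialD//; last by move=> y; rewrite mule_ge0.
apply: potential_min => // y; first by rewrite adde_ge0// mule_ge0.
rewrite [leRHS]potentialE// (mxapp_taboo x y M0 u0) -addeA.
by rewrite [_ * potential _ _ _]muleC.
Qed.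

(** Let [v] be the excursion potential with the value [t] paid on return. The hypothesis says v(x)
    <= t, which makes [v] a supersolution of u = r + M u. *)
Lemma potential_le_return M (r : S -> \bar R) x (t : R) :
  ge0_mx M -> ge0_fun r -> (0 <= t)%R ->
  potential (taboo x M) r x +
  potential (taboo x M) (fun y => (M y x)%:E) x * t%:E <= t%:E ->
  potential M r x <= potential (taboo x M) r x +
    potential (taboo x M) (fun y => (M y x)%:E) x * t%:E.
Proof.
move=> M0 r0 t0; have K0 := taboo_ge0 x M0.
have Mx0 : ge0_fun (fun y => (M y x)%:E) by move=> y; rewrite lee_fin M0.
have tM0 : ge0_fun (fun y => t%:E * (M y x)%:E) by move=> y; rewrite mule_ge0.
rewrite muleC -potentialZ// -potentialD//.
set v := potential (taboo x M) _ => le_t.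
have rt0 : ge0_fun (fun y => r y + t%:E * (M y x)%:E) by move=> y; rewrite adde_ge0.
have v0 : ge0_fun v by exact: potential_ge0.
apply: potential_min => // y.
rewrite [leRHS]potentialE// (mxapp_taboo x y M0 v0) -addeA.
apply: leeD => //; apply: leeD => //; rewrite [leRHS]muleC.
by apply: lee_wpmul2l.
Qed.

(** The constant 1 is a supersolution, as the rows of the discounted kernel sum to [k y <= 1]. *)
Lemma return_le1 k p x : discount k -> transition_matrix p ->
  potential (taboo x (scalemx k p)) (fun y => (scalemx k p y x)%:E) x <= 1.
Proof.
move=> k01 hp; have p0 : ge0_mx p by case: hp.
have k0 := discount_ge0 k01; have K0 := scalemx_ge0 k0 p0.
apply: (potential_min (v := fun=> 1)) => //.
- exact: taboo_ge0.
- by move=> y; rewrite lee_fin K0.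
move=> y; rewrite -[X in X + _]mule1.
rewrite -(mxapp_taboo (f := fun=> 1) x y K0)// mxapp_scalemx1// lee_fin.
exact: discount_le1.
Qed.

(* If the discounted chain surely returns to [x], then no mass is lost along
   the excursion, so its occupation measure is invariant for [p] itself. *)
Lemma sure_return_occupation_gt0 k p pi x : discount k ->
  transition_matrix p -> stationary_distribution p pi -> irreducible_matrix p ->
  potential (taboo x (scalemx k p)) (fun y => (scalemx k p y x)%:E) x = 1 ->
  forall y, 0 < occupation x (scalemx k p) y.
Proof.
move=> k01 hp hpi hirr F1; have p0 : ge0_mx p by case: hp.
have k0 := discount_ge0 k01; have K0 := scalemx_ge0 k0 p0.
set m := occupation _ _; have m0 : ge0_fun m by exact: occupation_ge0.
(* Off [x] this is the occupation equation; at [x] the right side is the return weight, equal to 1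
   by assumption. *)
have inv y : m y = mxapp (mxtr (scalemx k p)) m y.
  rewrite {1}/m occupationE//; case: eqP => // ->; rewrite -F1 potential_taboo//.
    by apply: eq_esum => z _; rewrite muleC.
  by move=> z; rewrite lee_fin K0.
(* The undiscounted occupation measure dominates [m], and its mass is at most 1 / pi(x). *)
have summ : \esum_(y in [set: S]) m y < +oo.
  apply: (@le_lt_trans _ _ (\esum_(y in [set: S]) occupation x p y)).
    apply: le_esum => y _; apply: le_potential => //.
    - by apply: mxtr_ge0; exact: taboo_ge0.
    - by move=> u v; rewrite /mxtr /taboo; case: ifP => // _; exact: scalemx_le.
    - exact: delta_ge0.
  have pix := stationary_gt0 hp hpi hirr x.
  rewrite ltey; apply/eqP => soo.
  have : \esum_(y in [set: S]) ((pi x)%:E * occupation x p y) <= 1.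
    case: (hpi) => _ <- _; apply: le_esum => y _.
    exact: occupation_le_stationary.
  rewrite esumZl ?lee_fin ?(ltW pix)//; last exact: occupation_ge0.
  by rewrite soo gt0_muley ?lte_fin.
(* Summing the invariance of [m] shows that [m] and [m k] have the same finite mass; hence k = 1
   wherever m > 0. *)
have mk : forall y, m y * (k y)%:E = m y.
  apply: esum_le_eq.
  - by move=> y; rewrite mule_ge0// lee_fin.
  - by move=> y; rewrite -[leRHS]mule1 lee_wpmul2l// lee_fin discount_le1.
  - apply: le_lt_trans summ; apply: le_esum => y _.
    by rewrite -[leRHS]mule1 lee_wpmul2l// lee_fin discount_le1.
  - rewrite (eq_esum (fun y _ => inv y)) esum_mxapp_mxtr//.
    by apply: le_esum => y _; rewrite mxapp_scalemx1.
have mx : 0 < m x by rewrite /m occupationE// eqxx.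
have mle y : mxapp (mxtr p) m y <= m y.
  rewrite [leRHS]inv; apply: le_esum => z _.
  by rewrite /mxtr /scalemx EFinM [(k z)%:E * _]muleC -muleA [(k z)%:E * _]muleC mk.
exact: (excessive_gt0 hp hirr m0 mle mx).
Qed.

End DiscountedKernel.

(** * Convergence over one excursion *)

Section Convergence.
Set Implicit Arguments. Unset Strict Implicit.
Context (R : realType) (S : countType).
Local Open Scope ereal_scope.
Context (k : S -> R) (p : nat -> S -> S -> R) (p' : S -> S -> R)
  (pi : nat -> S -> R) (pi' : S -> R).
Context (k01 : discount k)
  (hp : forall n, transition_matrix (p n)) (hp' : transition_matrix p')
  (hpi : forall n, stationary_distribution (p n) (pi n))
  (hpi' : stationary_distribution p' pi')
  (hirr : irreducible_matrix p')
  (pcvg : forall y z, p n y z @[n --> \oo] --> p' y z)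
  (picvg : forall y, pi n y @[n --> \oo] --> pi' y).

Let p0 n : ge0_mx (p n). Proof. by case: (hp n). Qed.
Let p'0 : ge0_mx p'. Proof. by case: hp'. Qed.
Let k0 := discount_ge0 k01.

Lemma taboo_cvg x (M : nat -> S -> S -> R) (M' : S -> S -> R) :
  (forall y z, M n y z @[n --> \oo] --> M' y z) ->
  forall y z, taboo x (M n) y z @[n --> \oo] --> taboo x M' y z.
Proof. by move=> MM y z; rewrite /taboo; case: ifP => // _; exact: cvg_cst. Qed.

Lemma scalemx_cvg (c : S -> R) y z :
  scalemx c (p n) y z @[n --> \oo] --> scalemx c p' y z.
Proof. by apply: cvgM; [exact: cvg_cst|exact: pcvg]. Qed.

Section Dominated.
Context (x : S) (w : S -> R) (w0 : forall y, (0 <= w y)%R)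
  (wcvg : \esum_(y in [set: S]) (pi n y * w y)%:E @[n --> \oo]
     --> \esum_(y in [set: S]) (pi' y * w y)%:E)
  (wfin : \esum_(y in [set: S]) (pi' y * w y)%:E < +oo).

Let a n := potential (taboo x (p n)) (EFin \o w).
Let a' := potential (taboo x p') (EFin \o w).

Lemma potential_taboo_fin : a' x < +oo.
Proof.
have pix := stationary_gt0 hp' hpi' hirr x.
rewrite ltey; apply/eqP => aoo; move: wfin.
have := potential_taboo_stationary hp' hpi' hirr x (EFin_ge0_fun w0).
rewrite -/a' aoo gt0_muley ?lte_fin// => h.
by rewrite (_ : esum _ _ = +oo) ?ltxx// h; apply: eq_esum => y _; rewrite EFinM.
Qed.

(** Here pi_n(x) a_n(x) is at most the [w]-mean under pi_n, with equality in the limit by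
    irreducibility; the means converge and pi_n(x) tends to a positive number. *)
Lemma usc_lim_potential_taboo : usc_lim (fun n => a n x) (a' x).
Proof.
move=> t at'.
have pix := stationary_gt0 hp' hpi' hirr x.
have := potential_taboo_stationary hp' hpi' hirr x (EFin_ge0_fun w0).
have -> : \esum_(y in [set: S]) ((pi' y)%:E * (EFin \o w) y) =
          \esum_(y in [set: S]) (pi' y * w y)%:E.
  by apply: eq_esum => y _; rewrite EFinM.
rewrite -/a' => WE.
have Wt : \esum_(y in [set: S]) (pi' y * w y)%:E < (pi' x * t)%:E.
  by rewrite -WE EFinM lte_pmul2l.
(* [M] separates the limiting mean from pi'(x) t; eventually it also separates the n-th mean from
   pi_n(x) t, which contradicts a_n(x) >= t. *)
have [M /andP[WM Mt]] : exists M : R,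
    (\esum_(y in [set: S]) (pi' y * w y)%:E < M%:E) && (M < pi' x * t)%R.
  move: Wt wfin; have : 0 <= \esum_(y in [set: S]) (pi' y * w y)%:E.
    apply: esum_ge0 => y _; rewrite lee_fin mulr_ge0//.
    by case: hpi' => + _ _; apply.
  case: (esum _ _) => // W _; rewrite lte_fin => Wt _.
  by exists ((W + pi' x * t) / 2)%R; rewrite lte_fin; apply/andP; split; lra.
have h1 := cvg_usc_lim wcvg WM.
have h2 : \forall n \near \oo, (M < pi n x * t)%R.
  by apply: (cvgr_gt _ _ _ Mt); apply: cvgM; [exact: picvg|exact: cvg_cst].
near=> n; rewrite ltNge; apply/negP => ta.
have : \esum_(y in [set: S]) (pi n y * w y)%:E < M%:E by near: n.
rewrite ltNge => /negP; apply; apply: (@le_trans _ _ (pi n x * t)%:E).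
  by rewrite lee_fin; apply: ltW; near: n.
apply: (@le_trans _ _ ((pi n x)%:E * a n x)).
  rewrite EFinM lee_wpmul2l// lee_fin; by case: (hpi n) => + _ _; apply.
apply: le_trans (potential_taboo_le_stationary (hp n) (hpi n) x (EFin_ge0_fun w0)) _.
by apply: le_esum => y _; rewrite EFinM.
Unshelve. all: by end_near. Qed.

(** The [w]-reward is upper semicontinuous with finite limit and splits into two lower
    semicontinuous parts, so each part converges. [th] depends on n so that the return column
    K_n(.,x) is covered too. *)
Lemma potential_taboo_cvg (th : nat -> S -> R) (th' : S -> R) :
  (forall n y, (0 <= th n y <= w y)%R) -> (forall y, (0 <= th' y <= w y)%R) ->
  (forall y, th n y @[n --> \oo] --> th' y) ->
  potential (taboo x (scalemx k (p n))) (EFin \o th n) x @[n --> \oo] -->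
  potential (taboo x (scalemx k p')) (EFin \o th') x.
Proof.
move=> thw thw' thcvg.
have K0 n : ge0_mx (taboo x (scalemx k (p n))) by exact/taboo_ge0/scalemx_ge0.
have K'0 : ge0_mx (taboo x (scalemx k p')) by exact/taboo_ge0/scalemx_ge0.
have k'0 y : (0 <= 1 - k y)%R by rewrite subr_ge0 discount_le1.
have D0 n : ge0_mx (taboo x (scalemx (fun z => 1 - k z)%R (p n))).
  exact/taboo_ge0/scalemx_ge0.
have D'0 : ge0_mx (taboo x (scalemx (fun z => 1 - k z)%R p')).
  exact/taboo_ge0/scalemx_ge0.
have T0 n : ge0_mx (taboo x (p n)) by exact: taboo_ge0.
have T'0 : ge0_mx (taboo x p') by exact: taboo_ge0.
have we0 := EFin_ge0_fun w0.
have th0 n : ge0_fun (EFin \o th n) by move=> y; rewrite lee_fin; have /andP[] := thw n y.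
have th'0 : ge0_fun (EFin \o th') by move=> y; rewrite lee_fin; have /andP[] := thw' y.
have a0 n : ge0_fun (a n) by exact: potential_ge0.
have a'0 : ge0_fun a' by exact: potential_ge0.
have wth0 n y : 0 <= (w y - th n y)%:E by rewrite lee_fin subr_ge0; have /andP[] := thw n y.
have wth'0 y : 0 <= (w y - th' y)%:E by rewrite lee_fin subr_ge0; have /andP[] := thw' y.
have g0 n : ge0_fun (fun y => (w y - th n y)%:E +
    mxapp (taboo x (scalemx (fun z => 1 - k z)%R (p n))) (a n) y).
  by move=> y; rewrite adde_ge0// mxapp_ge0.
have g'0 : ge0_fun (fun y => (w y - th' y)%:E +
    mxapp (taboo x (scalemx (fun z => 1 - k z)%R p')) a' y).
  by move=> y; rewrite adde_ge0// mxapp_ge0.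
apply: lsc_usc_cvg; first exact: potential_ge0.
  apply: (lsc_lim_potential (f := fun n => EFin \o th n)) => //.
    by apply: taboo_cvg; exact: scalemx_cvg.
  by move=> y; apply: cvg_lsc_lim; apply: cvg_EFin; [exact: nearW|exact: thcvg].
apply: (@usc_lim_cancel R (fun n => a n x) _ _ (a' x) _ _ _ _ _ _ _
  usc_lim_potential_taboo (lsc_lim_potential (y := x) K0 K'0 _ g0 g'0 _)) => //.
- exact: potential_taboo_fin.
- exact: potential_ge0.
- by move=> n; rewrite [leRHS](potential_taboo_split x k01 (p0 n) (thw n)).
- by rewrite [leLHS](potential_taboo_split x k01 p'0 thw').
- by apply: taboo_cvg; exact: scalemx_cvg.
move=> y; apply: lsc_limD => //; first exact: mxapp_ge0.
  apply: cvg_lsc_lim; apply: cvg_EFin; first exact: nearW.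
  by apply: cvgB; [exact: cvg_cst|exact: thcvg].
apply: lsc_lim_mxapp => //; first by apply: taboo_cvg; exact: scalemx_cvg.
apply: (lsc_lim_potential (f := fun=> EFin \o w)) => //; first exact: taboo_cvg.
by move=> z; exact: cst_lsc_lim.
Qed.

End Dominated.
End Convergence.

(** * Convergence of the discounted potentials *)

Section PotentialConvergence.
Set Implicit Arguments. Unset Strict Implicit.
Context (R : realType) (S : countType).
Local Open Scope ereal_scope.

Lemma potential_cvg (k : S -> R) (p : nat -> S -> S -> R) (p' : S -> S -> R)
    (pi : nat -> S -> R) (pi' : S -> R) (w r : S -> R) (x : S) :
  discount k ->
  (forall n, transition_matrix (p n)) -> transition_matrix p' ->
  (forall n, stationary_distribution (p n) (pi n)) ->
  stationary_distribution p' pi' -> irreducible_matrix p' ->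
  (forall y z, p n y z @[n --> \oo] --> p' y z) ->
  (forall y, pi n y @[n --> \oo] --> pi' y) ->
  \esum_(y in [set: S]) (pi n y * w y)%:E @[n --> \oo]
    --> \esum_(y in [set: S]) (pi' y * w y)%:E ->
  \esum_(y in [set: S]) (pi' y * w y)%:E < +oo ->
  (forall y, (0 <= r y <= w y)%R) ->
  potential (scalemx k (p n)) (EFin \o r) x @[n --> \oo] -->
  potential (scalemx k p') (EFin \o r) x.
Proof.
move=> k01 hp hp' hpi hpi' hirr pcvg picvg wcvg wfin rw.
have k0 := discount_ge0 k01.
have K0 n : ge0_mx (scalemx k (p n)) by apply: scalemx_ge0 => //; case: (hp n).
have K'0 : ge0_mx (scalemx k p') by apply: scalemx_ge0 => //; case: hp'.
have w0 y : (0 <= w y)%R by have /andP[/le_trans + ?] := rw y; exact.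
have re0 : ge0_fun (EFin \o r) by move=> y; rewrite lee_fin; have /andP[] := rw y.
have u'0 : ge0_fun (potential (scalemx k p') (EFin \o r)) by exact: potential_ge0.
apply: lsc_usc_cvg => //.
  apply: (lsc_lim_potential (f := fun=> EFin \o r)) => //.
    by move=> y z; exact: scalemx_cvg.
  by move=> y; exact: cst_lsc_lim.
(* For the upper bound it is enough that h_n + F_n t < t eventually: then [potential_le_return]
   gives u_n(x) < t. *)
move=> t ut.
have hcvg : potential (taboo x (scalemx k (p n))) (EFin \o r) x @[n --> \oo] -->
    potential (taboo x (scalemx k p')) (EFin \o r) x.
  exact: (potential_taboo_cvg k01 hp hp' hpi hpi' hirr pcvg picvg w0 wcvg wfin
  (x := x) (th := fun=> r) (th' := r) (fun=> rw) rw (fun=> cvg_cst _)).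
(* The return weight is dominated by w = 1, whose stationary means are all 1. *)
have sum1 q s : stationary_distribution q s ->
    \esum_(y in [set: S]) (s y * 1)%:E = 1 :> \bar R.
  by case=> _ <- _; apply: eq_esum => y _; rewrite mulr1.
have K01 n y : (0 <= scalemx k (p n) y x <= 1)%R.
  by rewrite K0/= (le_trans (scalemx_le _ _ k01 _)) ?transition_le1//; case: (hp n).
have K'01 y : (0 <= scalemx k p' y x <= 1)%R.
  by rewrite K'0/= (le_trans (scalemx_le _ _ k01 _)) ?transition_le1//; case: hp'.
have Fcvg : potential (taboo x (scalemx k (p n)))
      (fun y => (scalemx k (p n) y x)%:E) x @[n --> \oo] -->
    potential (taboo x (scalemx k p')) (fun y => (scalemx k p' y x)%:E) x.
  apply: (potential_taboo_cvg k01 hp hp' hpi hpi' hirr pcvg picvg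
    (w := fun=> 1%R) _ _ _ (th := fun n y => scalemx k (p n) y x)
    (th' := fun y => scalemx k p' y x)) => //.
  - under eq_fun do rewrite (sum1 _ _ (hpi _)).
    by rewrite (sum1 _ _ hpi'); exact: cvg_cst.
  - by rewrite (sum1 _ _ hpi') ltry.
  - by move=> y; exact: scalemx_cvg.
have Mx0 : ge0_fun (fun y => (scalemx k p' y x)%:E) by move=> y; rewrite lee_fin K'0.
have T'0 := taboo_ge0 x K'0.
have h'0 := potential_ge0 T'0 re0 x.
have F'0 := potential_ge0 T'0 Mx0 x.
have F'1 := return_le1 x k01 hp'.
have ret := potential_ge_return x K'0 re0.
have [u uE] : exists u, potential (scalemx k p') (EFin \o r) x = u%:E.
  by eexists; apply/esym/fineK; rewrite ge0_fin_numE//; exact: lt_trans ut (ltry _).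
have [F FE] : exists F, potential (taboo x (scalemx k p'))
    (fun y => (scalemx k p' y x)%:E) x = F%:E.
  by eexists; apply/esym/fineK; rewrite ge0_fin_numE//; exact: le_lt_trans F'1 (ltry _).
have [h hE] : exists h, potential (taboo x (scalemx k p')) (EFin \o r) x = h%:E.
  eexists; apply/esym/fineK; rewrite ge0_fin_numE//; apply: le_lt_trans (ltry u).
  by rewrite -uE; apply: le_trans ret; rewrite leeDl// mule_ge0.
have u0 : (0 <= u)%R by rewrite -lee_fin -uE.
rewrite uE lte_fin in ut; rewrite uE FE hE -EFinM -EFinD lee_fin in ret.
rewrite FE in F'0 F'1 Fcvg; rewrite hE in h'0 hcvg; rewrite !lee_fin in F'0 F'1 h'0.
(* If F = 1, then h + u <= u gives h = 0; the occupation measure is positive everywhere, so r = 0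
   and every u_n vanishes, while t > u >= 0. *)
have [F1'|F1'] := ltP F 1%R; last first.
  have F1 : F = 1%R by apply/eqP; rewrite eq_le F'1.
  have h0 : h = 0%R by apply/eqP; rewrite eq_le h'0 andbT; move: ret; rewrite F1 mul1r; lra.
  have o0 y : 0 < occupation x (scalemx k p') y.
    by apply: sure_return_occupation_gt0 hpi' _ _ _ => //; rewrite FE F1.
  have r0 y : r y = 0%R.
    have ro z : 0 <= occupation x (scalemx k p') z * (EFin \o r) z.
      by rewrite mule_ge0// occupation_ge0.
    move: hE; rewrite potential_taboo// h0 => /(esum_eq0P ro)/(_ y)/eqP.
    by rewrite mule_eq0 (gt_eqF (o0 y))/= => /eqP[].
  apply: nearW => n; apply: le_lt_trans (_ : 0 < t%:E); last by rewrite lte_fin; lra.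
  apply: (potential_min (v := fun=> 0)) => // y.
  by rewrite /= r0 add0e /mxapp esum1// => z _; rewrite mule0.
have t0 : (0 < t)%R by lra.
(* The slack [e] is positive because h + F u <= u, F < 1 and u < t. Errors of e/3 in h and e/(3t) in
   F use up only two thirds of it. *)
have [e eE] : exists e, e = (t - h - F * t)%R by eexists.
have e0 : (0 < e)%R.
  have : (F * (t - u) < t - u)%R by rewrite gtr_pMl// subr_gt0.
  by rewrite eE mulrBr; lra.
have hlt : h%:E < (h + e / 3)%:E by rewrite lte_fin; lra.
have Flt : F%:E < (F + e / (3 * t))%:E by rewrite lte_fin ltrDl divr_gt0// mulr_gt0.
have h1 := cvg_usc_lim hcvg hlt.
have h2 := cvg_usc_lim Fcvg Flt.
near=> n.
have lt_t : potential (taboo x (scalemx k (p n))) (EFin \o r) x +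
    potential (taboo x (scalemx k (p n))) (fun y => (scalemx k (p n) y x)%:E) x * t%:E
    < t%:E.
  apply: (@lt_le_trans _ _ ((h + e / 3)%:E + (F + e / (3 * t))%:E * t%:E)).
    by apply: lteD; [near: n|rewrite lte_pmul2r ?lte_fin//; near: n].
  rewrite -EFinM -EFinD lee_fin mulrDl.
  have -> : (e / (3 * t) * t = e / 3)%R by field; rewrite gt_eqF.
  by rewrite eE; lra.
apply: le_lt_trans (lt_t).
by apply: potential_le_return => //; exact: ltW.
Unshelve. all: by end_near. Qed.

End PotentialConvergence.

(** * Markov chains *)

Section DiscreteRandomVariables.
Set Implicit Arguments. Unset Strict Implicit.
Context (R : realType) (d : measure_display) (Omega : measurableType d).
Local Open Scope ereal_scope.

(** Measurability for the discrete sigma-algebra, stated through preimages so that it applies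
    directly to states, pairs and finite sequences. *)
Definition discrete_measurable (T : Type) (Y : Omega -> T) :=
  forall A : set T, measurable (Y @^-1` A).

Lemma discrete_measurable_comp (T U : Type) (Y : Omega -> T) (g : T -> U) :
  discrete_measurable Y -> discrete_measurable (g \o Y).
Proof. by move=> mY A; exact: (mY (g @^-1` A)). Qed.

Lemma discrete_measurable_pair (T U : countType) (Y : Omega -> T) (Z : Omega -> U) :
  discrete_measurable Y -> discrete_measurable Z ->
  discrete_measurable (fun o => (Y o, Z o)).
Proof.
move=> mY mZ A.
have -> : (fun o => (Y o, Z o)) @^-1` A =
    \bigcup_t (Y @^-1` [set t] `&` Z @^-1` [set u | A (t, u)]).
  apply/seteqP; split => o /=; first by move=> Ao; exists (Y o).
  by case=> t _ [/= <-].
apply: countable_bigcupT_measurable; first exact: countableP.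
by move=> t; apply: measurableI.
Qed.

Lemma discrete_measurable_fun (T : Type) (Y : Omega -> T) (g : T -> \bar R) :
  discrete_measurable Y -> measurable_fun [set: Omega] (fun o => g (Y o)).
Proof. by move=> mY _ B mB; rewrite setTI; exact: (mY (g @^-1` B)). Qed.

Lemma integral_discrete (mu : probability Omega R) (T : countType)
    (Y : Omega -> T) (g : T -> \bar R) :
  discrete_measurable Y -> (forall s, 0 <= g s) ->
  \int[mu]_o g (Y o) = \esum_(s in [set: T]) (g s * mu (Y @^-1` [set s])).
Proof.
move=> mY g0.
pose h s s' := g s * ((s' == s)%:R : R)%:E.
have h0 s s' : 0 <= h s s' by rewrite mule_ge0// lee_fin.
(* [g (Y o)] is the series of [g s] times the indicator of Y = s, which is integrated term by
   term. *)
transitivity (\int[mu]_o \sum_(0 <= n <oo) oapp (h ^~ (Y o)) 0 (@pickle_inv T n)).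
  apply: eq_integral => o _; rewrite -(esum_countE (f := h ^~ (Y o)))//.
  rewrite (esum_delta (i := Y o)) ?h0// /h ?eqxx ?mule1// => s sY.
  by rewrite eq_sym (negbTE sY) mule0.
rewrite integral_nneseries//; last 2 first.
- move=> n; case: (pickle_inv n) => [s|] /=; last exact: measurable_cst.
  exact: (discrete_measurable_fun (h s) mY).
- by move=> n o _; case: (pickle_inv n) => [s|] /=.
rewrite esum_countE; last by move=> s; rewrite mule_ge0.
apply: eq_eseriesr => n _; case: (pickle_inv n) => [s|] /=; last exact: integral0.
rewrite ge0_integralZl//.
  congr (_ * _); rewrite -[Y @^-1` [set s]]setIT -integral_indic//.
  apply: eq_integral => o _; rewrite indicE; congr ((nat_of_bool _)%:R%:E).
  by apply/idP/idP => [/eqP e|/set_mem/= ->//]; exact/mem_set.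
exact: (discrete_measurable_fun (fun s' => ((s' == s)%:R : R)%:E) mY).
Qed.

End DiscreteRandomVariables.

(** * Path laws of a Markov chain *)

Section History.
Context {Omega S : Type}.

(** The states at times 0 to j - 1: [X j] itself is excluded, as in the exponent of the discount
    factor. *)
Definition history (X : nat -> Omega -> S) (j : nat) (o : Omega) : seq S :=
  mkseq (X ^~ o) j.

Lemma historyS (X : nat -> Omega -> S) (j : nat) (o : Omega) :
  history X j.+1 o = rcons (history X j o) (X j o).
Proof. exact: mkseqS. Qed.

End History.

Section MarkovChain.
Set Implicit Arguments. Unset Strict Implicit.
Context (R : realType) (d : measure_display) (Omega : measurableType d)
  (S : countType) (X : nat -> Omega -> S) (mu : probability Omega R)
  (p : S -> S -> R) (x : S).
Context (hX : markov_chain mu X p x) (p0 : ge0_mx p).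
Local Open Scope ereal_scope.

Let mX j : discrete_measurable (X j). Proof. by case: hX => + _ _; apply. Qed.

Lemma discrete_measurable_history j : discrete_measurable (history X j).
Proof.
elim: j => [|j IH] A.
  have [A0|A0] := pselect (A [::]).
    rewrite [X in measurable X](_ : _ = setT)//.
    by apply/seteqP; split.
  by rewrite [X in measurable X](_ : _ = set0)//; apply/seteqP; split.
have := discrete_measurable_comp (fun q => rcons q.1 q.2)
  (discrete_measurable_pair IH (mX j)) A.
congr (measurable _); apply/seteqP; split => o /=; by rewrite historyS.
Qed.

(** The Markov property without division; both sides vanish on null histories. In particular the
    default [x] of [last] is reached only at the impossible history [[::]]. *)
Lemma markov_transition j (q : seq S) y :
  mu ((fun o => (history X j.+1 o, X j.+1 o)) @^-1` [set (q, y)]) =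
  (p (last x q) y)%:E * mu (history X j.+1 @^-1` [set q]).
Proof.
have mH := discrete_measurable_history j.+1.
have -> : (fun o => (history X j.+1 o, X j.+1 o)) @^-1` [set (q, y)] =
    [set o | X j.+1 o = y] `&` history X j.+1 @^-1` [set q].
  by apply/seteqP; split => o /= => [[-> ->]|[-> ->]].
have mA : measurable [set o | X j.+1 o = y] by exact: (mX _ [set y]).
have [H0|H0] := eqVneq (mu (history X j.+1 @^-1` [set q])) 0.
  apply/eqP; rewrite H0 mule0 eq_le measure_ge0 andbT -H0.
  by rewrite setIC; exact: measureIl.
have [t qE] : (history X j.+1 @^-1` [set q]) !=set0.
  by apply/set0P; apply: contra_neq H0 => ->; rewrite measure0.
(* A sample point [t] of the event supplies the state sequence on which the chain is conditioned. *)
have past : history X j.+1 @^-1` [set q] =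
    [set o | forall i, (i <= j)%N -> X i o = X i t].
  rewrite -qE; apply/seteqP; split => o /= h.
    by move=> i ij; have := congr1 (nth x ^~ i) h; rewrite !nth_mkseq.
  by apply/eq_in_map => i; rewrite mem_iota add0n ltnS => /andP[_ /h].
case: hX => _ _ /(_ j (fun i => X i t) y); rewrite -past => /(_ H0).
have -> : X j t = last x q by rewrite -qE historyS last_rcons.
move=> <-.
have Hf : mu (history X j.+1 @^-1` [set q]) \is a fin_num by exact: fin_num_measure.
have HAf : mu ([set o | X j.+1 o = y] `&` history X j.+1 @^-1` [set q]) \is a fin_num.
  by apply: fin_num_measure; exact: measurableI.
rewrite /cond_prob -[in RHS](fineK Hf) -EFinM divfK ?fineK//.
by rewrite -eqe fineK.
Qed.

Lemma markov_step j (phi : seq S -> R) (f : S -> \bar R) :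
  (forall q, (0 <= phi q)%R) -> ge0_fun f ->
  \int[mu]_o ((phi (history X j.+1 o))%:E * f (X j.+1 o)) =
  \int[mu]_o ((phi (history X j.+1 o))%:E * mxapp p f (X j o)).
Proof.
move=> phi0 f0; have mH := discrete_measurable_history j.+1.
have phie q : 0 <= (phi q)%:E by rewrite lee_fin.
rewrite (integral_discrete (g := fun q : seq S * S => (phi q.1)%:E * f q.2)
  mu (discrete_measurable_pair mH (mX j.+1))); last by move=> q; rewrite mule_ge0.
transitivity (\int[mu]_o ((phi (history X j.+1 o))%:E *
    mxapp p f (last x (history X j.+1 o)))); last first.
  by apply: eq_integral => o _; rewrite [in last _ _]historyS last_rcons.
rewrite (integral_discrete (g := fun q => (phi q)%:E * mxapp p f (last x q)) mu mH);
  last by move=> q; rewrite mule_ge0// mxapp_ge0.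
transitivity (\esum_(q in [set: seq S]) \esum_(y in [set: S])
   ((phi q)%:E * f y * ((p (last x q) y)%:E * mu (history X j.+1 @^-1` [set q])))).
  rewrite esum_esum; last by move=> q y _ _; rewrite !mule_ge0// lee_fin.
  rewrite (_ : _ `*`` _ = setT); last by apply/seteqP; split.
  by apply: eq_esum => -[q y] _ /=; rewrite markov_transition.
apply: eq_esum => q _; rewrite muleAC -esumZl; last 2 first.
- by rewrite mule_ge0.
- by move=> y; exact: mxterm_ge0.
by apply: eq_esum => y _; rewrite [LHS]muleACA [RHS]muleACA [f y * _]muleC.
Qed.

(** A discrete Feynman-Kac formula. The induction removes the last step: conditioning replaces [f]
    by p f at time j, and the weight k(X_j) of the longer history turns this into K f. *)
Lemma integral_history (k : S -> R) j (f : S -> \bar R) :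
  (forall y, (0 <= k y)%R) -> ge0_fun f ->
  \int[mu]_o ((\prod_(s <- history X j o) k s)%:E * f (X j o)) =
  iter j (mxapp (scalemx k p)) f x.
Proof.
move=> k0; have prod0 q : (0 <= \prod_(s <- q) k s)%R by exact: prodr_ge0.
have K0 := scalemx_ge0 k0 p0.
elim: j f => [|j IH] f f0.
  transitivity (\int[mu]_o f (X 0%N o)).
    by apply: eq_integral => o _; rewrite big_nil mul1e.
  rewrite integral_discrete// (esum_delta (i := x)).
  - by case: hX => _ + _; rewrite /preimage/= => ->; rewrite mule1.
  - by rewrite mule_ge0.
  - move=> y yx; apply/eqP; rewrite mule_eq0; apply/orP; right.
    rewrite eq_le measure_ge0 andbT.
    have hx : mu (X 0%N @^-1` [set x]) = 1 by case: hX.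
    rewrite -(subee (x := 1)) // -{2}hx -probability_setC//; last exact: mX.
    apply: le_measure; rewrite ?inE; first exact: mX.
      by apply: measurableC; exact: mX.
    by move=> o /= -> /eqP; rewrite (negbTE yx).
rewrite (markov_step j (phi := fun q => \prod_(s <- q) k s)%R)// iterSr -IH; last first.
  exact: mxapp_ge0.
apply: eq_integral => o _; rewrite historyS -cats1 big_cat big_seq1 EFinM -muleA.
congr (_ * _); rewrite /mxapp -esumZl ?lee_fin//; last by move=> z; exact: mxterm_ge0.
by apply: eq_esum => z _; rewrite EFinM muleA.
Qed.

End MarkovChain.

(** * The expected reward as a potential *)

Section Reward.
Set Implicit Arguments. Unset Strict Implicit.
Context (R : realType) (S : countType).
Local Open Scope ereal_scope.

(** The value 0 off [C] encodes the stopping at T: the product over a history vanishes once it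
    contains a state outside [C], while the reward at time T itself is kept. *)
Definition killing (C : set S) (alpha : S -> R) (y : S) : R :=
  if y \in C then expR (- alpha y) else 0%R.

Lemma killing_discount (C : set S) (alpha : S -> R) :
  (forall y, (0 <= alpha y)%R) -> discount (killing C alpha).
Proof.
move=> a0 y; rewrite /killing; case: ifP => _; last by rewrite lexx ler01.
by rewrite expR_ge0/= -[leRHS]expR0 ler_expR oppr_le0.
Qed.

Lemma le_exit_time (Omega : Type) (C : set S) (X : nat -> Omega -> S) o j :
  (j%:R%:E <= exit_time R C X o) = all (fun y => y \in C) (history X j o).
Proof.
apply/ereal_infP/allP => [h y /mapP[i]|h _ [i nC <-]].
  rewrite mem_iota add0n => /andP[_ ij] ->; apply: contraPT ij => nC.
  apply/negP; rewrite -leqNgt -(ler_nat R) -lee_fin; apply: h; exists i => //=.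
  by move: nC; rewrite /= notin_setE.
rewrite lee_fin ler_nat leqNgt; apply/negP => ij; apply: nC.
by apply/set_mem/h/mapP; exists i; rewrite ?mem_iota.
Qed.

Lemma total_discounted_rewardE (Omega : Type) (C : set S) (alpha r : S -> R)
    (X : nat -> Omega -> S) o :
  total_discounted_reward C alpha r X o =
  \sum_(0 <= j <oo) ((\prod_(s <- history X j o) killing C alpha s)%:E * (r (X j o))%:E).
Proof.
rewrite /total_discounted_reward eseries_mkcond; apply: eq_eseriesr => j _.
(* For j > T the history contains a state outside [C], hence a zero factor; for j <= T the product
   is the exponential of the sum. *)
rewrite le_exit_time; case: ifPn => [/allP h|/allPn[y yh nC]]; last first.
  by rewrite (big_rem y)//= {1}/killing (negbTE nC) !mul0r mul0e.
rewrite -EFinM; congr ((_ * _)%:E).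
rewrite -sumrN expR_sum big_map /index_iota subn0 !big_seq.
apply: eq_bigr => i ij; rewrite /killing ifT//.
by apply: h; exact: map_f.
Qed.

Lemma ustar_potential (d : measure_display) (Omega : measurableType d)
    (C : set S) (alpha r : S -> R) (X : nat -> Omega -> S)
    (mu : probability Omega R) (p : S -> S -> R) (x : S) :
  markov_chain mu X p x -> ge0_mx p ->
  (forall y, (0 <= alpha y)%R) -> (forall y, (0 <= r y)%R) ->
  ustar C alpha r X mu = potential (scalemx (killing C alpha) p) (EFin \o r) x.
Proof.
move=> hX p0 a0 r0; have k0 := discount_ge0 (killing_discount C a0).
rewrite /ustar; under eq_integral do rewrite total_discounted_rewardE.
have mX j : discrete_measurable (X j) by case: hX => + _ _; apply.
have prod0 q : (0 <= \prod_(s <- q) killing C alpha s)%R by exact: prodr_ge0.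
rewrite integral_nneseries//; last 2 first.
- move=> j.
  apply: (discrete_measurable_fun (Y := fun o => (history X j o, X j o)) (fun q : seq S * S =>
    (\prod_(s <- q.1) killing C alpha s)%:E * (r q.2)%:E)).
  by apply: discrete_measurable_pair => //; exact: discrete_measurable_history hX _.
- by move=> j o _; rewrite mule_ge0// lee_fin.
rewrite nneseries_esumT; last first.
  by move=> j; apply: integral_ge0 => o _; rewrite mule_ge0// lee_fin.
apply: eq_esum => j _.
exact: (integral_history hX p0 j k0 (EFin_ge0_fun r0)).
Qed.

End Reward.

(* The index set {1,2,...} U {oo} is [option nat]: [None] is oo and [Some k]
   is n = k + 1.  All laws P_{n,x} live on one measurable space Omega carrying
   the process X. *)
Theorem proposition3 (R : realType) (S : countType)
  (C : set S) (alpha w : S -> R)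
  (P : option nat -> S -> S -> R) (pi : option nat -> S -> R)
  (d : measure_display) (Omega : measurableType d)
  (X : nat -> Omega -> S) (Pr : option nat -> S -> probability Omega R)
  (hC : C !=set0)
  (halpha : forall x, 0 <= alpha x)
  (hw : forall x, 0 < w x)
  (hP : forall n, transition_matrix (P n))
  (hpi : forall n, stationary_distribution (P n) (pi n))
  (hirr : irreducible_matrix (P None))
  (hX : forall n x, markov_chain (Pr n x) X (P n) x)
  (hPlim : forall x y, P (Some n) x y @[n --> \oo] --> P None x y)
  (hpilim : forall x, pi (Some n) x @[n --> \oo] --> pi None x)
  (hwlim : esum [set: S] (fun x => (pi (Some n) x * w x)%:E) @[n --> \oo]
           --> esum [set: S] (fun x => (pi None x * w x)%:E))
  (hwfin : (esum [set: S] (fun x => (pi None x * w x)%:E) < +oo)%E) :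
  forall r : S -> R, (forall x, 0 <= r x) -> (forall x, r x <= w x) ->
  forall x : S,
    ustar C alpha r X (Pr (Some n) x) @[n --> \oo]
    --> ustar C alpha r X (Pr None x).
Proof.
move=> r r0 rw x; have p0 n : ge0_mx (P n) by case: (hP n).
rewrite (ustar_potential C (hX None x) (p0 None) halpha r0).
under eq_fun do rewrite (ustar_potential C (hX _ x) (p0 _) halpha r0).
apply: (potential_cvg (pi := fun n => pi (Some n)) (pi' := pi None) (w := w)) => //.
- exact: killing_discount.
- by move=> y; rewrite r0 rw.
Qed.
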